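(* Let $\mathcal{C}$ be a monoidal category and $(P,Q)$ a pivotal pair in $\mathcal{C}$. If $\mathcal{C}$ is right closed, then the monoidal category $\mathcal{C}(P,Q)$ has a right closed monoidal structure which lifts that of $\mathcal{C}$, and the forgetful functor $U:\mathcal{C}(P,Q)\to\mathcal{C}$, $(X,\sigma)\mapsto X$, is right closed.
   Context: Monoidal categories $(\mathcal{C},\otimes,\mathbf 1)$ are assumed strict; object names also denote identity morphisms. A pivotal pair $(P,Q)$ in $\mathcal{C}$ consists of objects $P,Q$ with morphisms $\mathrm{coev}:\mathbf 1\to P\otimes Q$, $\mathrm{ev}:Q\otimes P\to\mathbf 1$ making $Q$ a left dual of $P$, i.e. $(\mathrm{ev}\otimes Q)(Q\otimes\mathrm{coev})=\mathrm{id}_Q$, $(P\otimes\mathrm{ev})(\mathrm{coev}\otimes P)=\mathrm{id}_P$, and morphisms $\underline{\mathrm{coev}}:\mathbf 1\to Q\otimes P$, $\underline{\mathrm{ev}}:P\otimes Q\to\mathbf 1$ making $Q$ a right dual of $P$, i.e. $(\underline{\mathrm{ev}}\otimes P)(P\otimes\underline{\mathrm{coev}})=\mathrm{id}_P$, $(Q\otimes\underline{\mathrm{ev}})(\underline{\mathrm{coev}}\otimes Q)=\mathrm{id}_Q$. The category $\mathcal{C}(P,Q)$: objects are pairs $(X,\sigma)$ with $X$ an object of $\mathcal{C}$ and $\sigma:X\otimes P\to P\otimes X$ an invertible morphism such that the two morphisms $$(\mathrm{ev}\otimes X\otimes Q)(Q\otimes\sigma\otimes Q)(Q\otimes X\otimes\mathrm{coev}):Q\otimes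 X\to X\otimes Q,$$ $$(Q\otimes X\otimes\underline{\mathrm{ev}})(Q\otimes\sigma^{-1}\otimes Q)(\underline{\mathrm{coev}}\otimes X\otimes Q):X\otimes Q\to Q\otimes X$$ are inverse to each other. Morphisms $(X,\sigma)\to(Y,\tau)$ are morphisms $f:X\to Y$ in $\mathcal{C}$ with $\tau(f\otimes P)=(P\otimes f)\sigma$. It is monoidal via $(X,\sigma)\otimes(Y,\tau)=(X\otimes Y,(\sigma\otimes Y)(X\otimes\tau))$ with unit $(\mathbf 1,\mathrm{id}_P)$, and $U$ is strict monoidal. A monoidal category is right closed if for every object $A$ the functor $A\otimes-$ has a right adjoint $[A,-]^{r}$. The right closed structure of $\mathcal{C}$ lifts to $\mathcal{C}(P,Q)$ if for each $(A,\sigma_A)$ the functor $(A,\sigma_A)\otimes-$ has a right adjoint $[(A,\sigma_A),-]^{r}$ with $U[(A,\sigma_A),-]^{r}=[A,U(-)]^{r}$ and such that $U$ sends its unit and counit to those of $A\otimes-\dashv[A,-]^{r}$. A monoidal functor $F$ between right closed categories is right closed if the canonical morphisms $F([X,Y]^{r})\to[F(X),F(Y)]^{r}$ are isomorphisms for all $X,Y$. *)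

(* Defs.v *)
From mathcomp Require Import ssreflect ssrfun ssrbool.
From mathcomp Require Import boolp.

Set Implicit Arguments.
Unset Strict Implicit.
Unset Printing Implicit Defensive.

Declare Scope cat_scope.
Delimit Scope cat_scope with cat.
Local Open Scope cat_scope.

(* Categories are presented with one type of objects and one type of arrows,
   related by [dom] and [cod].  With this presentation the equations of a strict
   monoidal category, and equalities between functors, are plain equalities, with
   no transport along equalities of objects.  [comp g f] is meaningful only when
   [cod f = dom g]; its value on other pairs is arbitrary, and no axiom and no
   definition below depends on it. *)
Record category := Category {
  ob : Type;
  mor : Type;
  dom : mor -> ob;
  cod : mor -> ob;
  idm : ob -> mor;
  comp : mor -> mor -> mor;
  dom_idm : forall X, dom (idm X) = X;
  cod_idm : forall X, cod (idm X) = X;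
  dom_comp : forall g f, cod f = dom g -> dom (comp g f) = dom f;
  cod_comp : forall g f, cod f = dom g -> cod (comp g f) = cod g;
  comp_idl : forall f, comp (idm (cod f)) f = f;
  comp_idr : forall f, comp f (idm (dom f)) = f;
  compA : forall h g f, cod f = dom g -> cod g = dom h ->
    comp h (comp g f) = comp (comp h g) f
}.

Arguments idm {c} X.
Arguments comp {c} g f.

(* As in the literature, an object also denotes its identity morphism. *)
Coercion idm : ob >-> mor.

Definition is_hom (C : category) (X Y : ob C) (f : mor C) : Prop :=
  dom f = X /\ cod f = Y.

Notation "g ∘ f" := (comp g f) (at level 50, left associativity) : cat_scope.
Notation "f ∈ X ⟶ Y" := (is_hom X Y f)
  (at level 70, X at level 60, Y at level 60, no associativity) : cat_scope.

Definition inverse_pair (C : category) (X Y : ob C) (f g : mor C) : Prop :=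
  [/\ f ∈ X ⟶ Y, g ∈ Y ⟶ X, g ∘ f = X & f ∘ g = Y].

Definition is_iso (C : category) (f : mor C) : Prop :=
  exists g, inverse_pair (dom f) (cod f) f g.

Record functor (C D : category) := Functor {
  fob : ob C -> ob D;
  fmor : mor C -> mor D;
  dom_fmor : forall f, dom (fmor f) = fob (dom f);
  cod_fmor : forall f, cod (fmor f) = fob (cod f);
  fmor_idm : forall X : ob C, fmor X = fob X;
  fmor_comp : forall g f, cod f = dom g -> fmor (g ∘ f) = fmor g ∘ fmor f
}.

Definition eq_functor (C D : category) (F G : functor C D) : Prop :=
  (forall X, fob F X = fob G X) /\ (forall f, fmor F f = fmor G f).

Section FunctorComposition.
Variables (C D E : category) (G : functor D E) (F : functor C D).

Lemma functor_comp_idm (X : ob C) : fmor G (fmor F X) = fob G (fob F X).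
Proof. by rewrite !fmor_idm. Qed.

Lemma functor_comp_comp g f : cod f = dom g ->
  fmor G (fmor F (g ∘ f)) = fmor G (fmor F g) ∘ fmor G (fmor F f).
Proof. by move=> e; rewrite !fmor_comp // cod_fmor dom_fmor e. Qed.

Lemma functor_comp_dom f : dom (fmor G (fmor F f)) = fob G (fob F (dom f)).
Proof. by rewrite !dom_fmor. Qed.

Lemma functor_comp_cod f : cod (fmor G (fmor F f)) = fob G (fob F (cod f)).
Proof. by rewrite !cod_fmor. Qed.

Definition functor_comp : functor C E :=
  @Functor C E (fun X => fob G (fob F X)) (fun f => fmor G (fmor F f))
    functor_comp_dom functor_comp_cod functor_comp_idm functor_comp_comp.

End FunctorComposition.

(* F ⊣ G, given by unit and counit. *)
Record adjunction (C D : category) (F : functor C D) (G : functor D C) :=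
  Adjunction {
  adj_unit : ob C -> mor C;
  adj_counit : ob D -> mor D;
  adj_unit_hom : forall X, adj_unit X ∈ X ⟶ fob G (fob F X);
  adj_counit_hom : forall Y, adj_counit Y ∈ fob F (fob G Y) ⟶ Y;
  adj_unit_nat : forall f,
    adj_unit (cod f) ∘ f = fmor G (fmor F f) ∘ adj_unit (dom f);
  adj_counit_nat : forall f,
    adj_counit (cod f) ∘ fmor F (fmor G f) = f ∘ adj_counit (dom f);
  triangleL : forall X, adj_counit (fob F X) ∘ fmor F (adj_unit X) = fob F X;
  triangleR : forall Y, fmor G (adj_counit Y) ∘ adj_unit (fob G Y) = fob G Y
}.

(* Strict monoidal categories: [otens] is the tensor product of objects (written
   ⊙) and [mtens] that of morphisms (written ⊗, also applied to objects through
   their identities). *)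
Record monoidal := Monoidal {
  moncat :> category;
  one : ob moncat;
  otens : ob moncat -> ob moncat -> ob moncat;
  mtens : mor moncat -> mor moncat -> mor moncat;
  dom_mtens : forall f g, dom (mtens f g) = otens (dom f) (dom g);
  cod_mtens : forall f g, cod (mtens f g) = otens (cod f) (cod g);
  mtens_idm : forall X Y : ob moncat, mtens X Y = otens X Y;
  interchange : forall g f g' f', cod f = dom g -> cod f' = dom g' ->
    mtens (g ∘ f) (g' ∘ f') = mtens g g' ∘ mtens f f';
  otensA : forall X Y Z, otens X (otens Y Z) = otens (otens X Y) Z;
  otens1l : forall X, otens one X = X;
  otens1r : forall X, otens X one = X;
  mtensA : forall f g h, mtens f (mtens g h) = mtens (mtens f g) h;
  mtens1l : forall f, mtens one f = f;
  mtens1r : forall f, mtens f one = f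
}.

Arguments one {m}.
Arguments otens {m} X Y.
Arguments mtens {m} f g.

Notation "X ⊙ Y" := (otens X Y) (at level 40, left associativity) : cat_scope.
Notation "f ⊗ g" := (mtens f g) (at level 40, left associativity) : cat_scope.

Section TensorLeft.
Variables (C : monoidal) (A : ob C).

Lemma tensor_left_dom (f : mor C) : dom (A ⊗ f) = A ⊙ dom f.
Proof. by rewrite dom_mtens dom_idm. Qed.

Lemma tensor_left_cod (f : mor C) : cod (A ⊗ f) = A ⊙ cod f.
Proof. by rewrite cod_mtens cod_idm. Qed.

Lemma tensor_left_comp (g f : mor C) : cod f = dom g ->
  A ⊗ (g ∘ f) = (A ⊗ g) ∘ (A ⊗ f).
Proof.
move=> e; rewrite -interchange ?cod_idm ?dom_idm //.
by have := comp_idl (A : mor C); rewrite cod_idm => ->.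
Qed.

Definition tensor_left : functor C C :=
  @Functor C C (fun X => A ⊙ X) (fun f => A ⊗ f)
    tensor_left_dom tensor_left_cod (mtens_idm A) tensor_left_comp.

End TensorLeft.

(* A right closed structure: a right adjoint [A, -]^r of A ⊗ - for each A. *)
Record right_closed (C : monoidal) := RightClosed {
  ihom : ob C -> functor C C;
  ihom_adj : forall A, adjunction (tensor_left A) (ihom A)
}.

(* Lax monoidal functors, with structure morphisms mu (binary) and mu0 (unit). *)
Record monoidal_functor (C D : monoidal) := MonoidalFunctor {
  monfun :> functor C D;
  mu : ob C -> ob C -> mor D;
  mu0 : mor D;
  mu_hom : forall X Y, mu X Y ∈ fob monfun X ⊙ fob monfun Y ⟶ fob monfun (X ⊙ Y);
  mu0_hom : mu0 ∈ one ⟶ fob monfun one;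
  mu_nat : forall f g,
    mu (cod f) (cod g) ∘ (fmor monfun f ⊗ fmor monfun g) =
    fmor monfun (f ⊗ g) ∘ mu (dom f) (dom g);
  mu_assoc : forall X Y Z,
    mu (X ⊙ Y) Z ∘ (mu X Y ⊗ fob monfun Z) =
    mu X (Y ⊙ Z) ∘ (fob monfun X ⊗ mu Y Z);
  mu_unitl : forall X, mu one X ∘ (mu0 ⊗ fob monfun X) = fob monfun X;
  mu_unitr : forall X, mu X one ∘ (fob monfun X ⊗ mu0) = fob monfun X
}.

(* The canonical morphism F([X,Y]^r) -> [F X, F Y]^r: the transpose of
     F X ⊗ F [X,Y]^r -> F (X ⊗ [X,Y]^r) -> F Y. *)
Definition closed_comparison (C D : monoidal) (F : monoidal_functor C D)
    (RC : right_closed C) (RD : right_closed D) (X Y : ob C) : mor D :=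
  fmor (ihom RD (fob F X))
    (fmor F (adj_counit (ihom_adj RC X) Y) ∘ mu F X (fob (ihom RC X) Y))
  ∘ adj_unit (ihom_adj RD (fob F X)) (fob F (fob (ihom RC X) Y)).

Definition right_closed_functor (C D : monoidal) (F : monoidal_functor C D)
    (RC : right_closed C) (RD : right_closed D) : Prop :=
  forall X Y, is_iso (closed_comparison F RC RD X Y).

(* The right closed structure RC of C lifts along U : D -> C to RD: the internal
   homs, units and counits of RD are sent by U to those of RC.  Only meaningful
   when U is strict monoidal. *)
Definition lifts_right_closed (D C : monoidal) (U : functor D C)
    (RD : right_closed D) (RC : right_closed C) : Prop :=
  forall A : ob D,
    [/\ eq_functor (functor_comp U (ihom RD A))
                   (functor_comp (ihom RC (fob U A)) U),
        forall X, fmor U (adj_unit (ihom_adj RD A) X) =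
                  adj_unit (ihom_adj RC (fob U A)) (fob U X)
      & forall X, fmor U (adj_counit (ihom_adj RD A) X) =
                  adj_counit (ihom_adj RC (fob U A)) (fob U X)].

Record pivotal_pair (C : monoidal) := PivotalPair {
  pP : ob C;
  pQ : ob C;
  coev : mor C;
  ev : mor C;
  ucoev : mor C;
  uev : mor C;
  coev_hom : coev ∈ one ⟶ pP ⊙ pQ;
  ev_hom : ev ∈ pQ ⊙ pP ⟶ one;
  ucoev_hom : ucoev ∈ one ⟶ pQ ⊙ pP;
  uev_hom : uev ∈ pP ⊙ pQ ⟶ one;
  zigzagQ : (ev ⊗ pQ) ∘ (pQ ⊗ coev) = pQ;
  zigzagP : (pP ⊗ ev) ∘ (coev ⊗ pP) = pP;
  uzigzagP : (uev ⊗ pP) ∘ (pP ⊗ ucoev) = pP;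
  uzigzagQ : (pQ ⊗ uev) ∘ (ucoev ⊗ pQ) = pQ
}.

Section MonoidalLemmas.
Variable C : monoidal.
Implicit Types (X Y Z A B : ob C) (f g h : mor C).

Lemma hom_idm X : X ∈ X ⟶ X.
Proof. by split; rewrite ?dom_idm ?cod_idm. Qed.

Lemma hom_comp X Y Z f g : f ∈ X ⟶ Y -> g ∈ Y ⟶ Z -> g ∘ f ∈ X ⟶ Z.
Proof. by case=> <- e [e' <-]; split; rewrite ?dom_comp ?cod_comp // e e'. Qed.

Lemma hom_tens X Y X' Y' f g :
  f ∈ X ⟶ Y -> g ∈ X' ⟶ Y' -> f ⊗ g ∈ X ⊙ X' ⟶ Y ⊙ Y'.
Proof. by case=> <- <- [<- <-]; split; rewrite ?dom_mtens ?cod_mtens. Qed.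

Lemma hom_cast X Y X' Y' f :
  f ∈ X ⟶ Y -> X = X' -> Y = Y' -> f ∈ X' ⟶ Y'.
Proof. by move=> ? <- <-. Qed.

Lemma compil X Y f : f ∈ X ⟶ Y -> Y ∘ f = f.
Proof. by case=> _ <-; rewrite comp_idl. Qed.

Lemma compir X Y f : f ∈ X ⟶ Y -> f ∘ X = f.
Proof. by case=> <- _; rewrite comp_idr. Qed.

Lemma comp3A W X Y Z f g h : f ∈ W ⟶ X -> g ∈ X ⟶ Y -> h ∈ Y ⟶ Z ->
  h ∘ (g ∘ f) = h ∘ g ∘ f.
Proof. by case=> _ ef [eg eg'] [eh _]; rewrite compA // ?ef ?eg ?eg' ?eh. Qed.

Lemma tens_comp X Y Z X' Y' Z' f g f' g' :
  f ∈ X ⟶ Y -> g ∈ Y ⟶ Z -> f' ∈ X' ⟶ Y' -> g' ∈ Y' ⟶ Z' ->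
  (g ∘ f) ⊗ (g' ∘ f') = (g ⊗ g') ∘ (f ⊗ f').
Proof. by case=> _ <- [e _] [_ <-] [e' _]; rewrite interchange. Qed.


Lemma hom_comp_eq X Y Y' Z f g :
  f ∈ X ⟶ Y -> g ∈ Y' ⟶ Z -> Y = Y' -> g ∘ f ∈ X ⟶ Z.
Proof. by move=> hf hg e; rewrite e in hf; exact: hom_comp hf hg. Qed.

Lemma whiskl A X Y Z f g : f ∈ X ⟶ Y -> g ∈ Y ⟶ Z ->
  A ⊗ (g ∘ f) = (A ⊗ g) ∘ (A ⊗ f).
Proof.
move=> hf hg; rewrite -(tens_comp (hom_idm A) (hom_idm A) hf hg).
by rewrite (compil (hom_idm A)).
Qed.

Lemma whiskr A X Y Z f g : f ∈ X ⟶ Y -> g ∈ Y ⟶ Z ->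
  (g ∘ f) ⊗ A = (g ⊗ A) ∘ (f ⊗ A).
Proof.
move=> hf hg; rewrite -(tens_comp hf hg (hom_idm A) (hom_idm A)).
by rewrite (compil (hom_idm A)).
Qed.

Lemma slide X Y X' Y' f g : f ∈ X ⟶ Y -> g ∈ X' ⟶ Y' ->
  (f ⊗ Y') ∘ (X ⊗ g) = (Y ⊗ g) ∘ (f ⊗ X').
Proof.
move=> hf hg.
rewrite -(tens_comp (hom_idm X) hf hg (hom_idm Y')).
rewrite -(tens_comp hf (hom_idm Y) (hom_idm X') hg).
by rewrite (compil hf) (compir hf) (compil hg) (compir hg).
Qed.

Lemma inverse_pair_id X : inverse_pair X X X X.
Proof. by split; rewrite ?(compil (hom_idm X)) //; exact: hom_idm. Qed.

Lemma inverse_pair_comp X Y Z f f' g g' :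
  inverse_pair X Y f f' -> inverse_pair Y Z g g' ->
  inverse_pair X Z (g ∘ f) (f' ∘ g').
Proof.
move=> [hf hf' ef ef'] [hg hg' eg eg']; split.
- exact: hom_comp hf hg.
- exact: hom_comp hg' hf'.
- rewrite (comp3A hf hg (hom_comp hg' hf')) -(comp3A hg hg' hf') eg.
  by rewrite (compir hf').
rewrite (comp3A hg' hf' (hom_comp hf hg)) -(comp3A hf' hf hg) ef'.
by rewrite (compir hg).
Qed.

Lemma inverse_pair_tens X Y X' Y' f f' g g' :
  inverse_pair X Y f f' -> inverse_pair X' Y' g g' ->
  inverse_pair (X ⊙ X') (Y ⊙ Y') (f ⊗ g) (f' ⊗ g').
Proof.
move=> [hf hf' ef ef'] [hg hg' eg eg']; split; try exact: hom_tens.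
- by rewrite -(tens_comp hf hf' hg hg') ef eg mtens_idm.
by rewrite -(tens_comp hf' hf hg' hg) ef' eg' mtens_idm.
Qed.

End MonoidalLemmas.

Ltac objeq := by rewrite ?otensA ?otens1l ?otens1r.
Ltac hom_infer :=
  lazymatch goal with
  | |- is_hom _ _ (comp _ _) => eapply hom_comp_eq; [hom_infer | hom_infer | objeq]
  | |- is_hom _ _ (mtens _ _) => eapply hom_tens; [hom_infer | hom_infer]
  | |- is_hom _ _ (idm _) => apply: hom_idm
  | |- _ => first [eassumption | solve [eauto with cathom]]
  end.
Ltac hom := eapply hom_cast; [hom_infer | objeq | objeq].

#[local] Hint Resolve coev_hom ev_hom ucoev_hom uev_hom : cathom.

Section Lifting.
Variables (C : monoidal) (pp : pivotal_pair C).
Implicit Types (X Y : ob C) (s t : mor C).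

Local Notation P := (pP pp).
Local Notation Q := (pQ pp).

(* For s : X ⊗ P -> P ⊗ X, the induced morphism Q ⊗ X -> X ⊗ Q. *)
Definition sharp X s : mor C :=
  (ev pp ⊗ X ⊗ Q) ∘ (Q ⊗ s ⊗ Q) ∘ (Q ⊗ X ⊗ coev pp).

(* For t : P ⊗ X -> X ⊗ P, the induced morphism X ⊗ Q -> Q ⊗ X. *)
Definition flat X t : mor C :=
  (Q ⊗ X ⊗ uev pp) ∘ (Q ⊗ t ⊗ Q) ∘ (ucoev pp ⊗ X ⊗ Q).

(* s : X ⊗ P -> P ⊗ X makes (X, s) an object of C(P,Q); t is the inverse of s. *)
Definition pq_axiom X s : Prop :=
  exists t, inverse_pair (X ⊙ P) (P ⊙ X) s t /\
            inverse_pair (Q ⊙ X) (X ⊙ Q) (sharp X s) (flat X t).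

Let sharp_core X s := (s ⊗ Q) ∘ (X ⊗ coev pp).
Let flat_core X t := (X ⊗ uev pp) ∘ (t ⊗ Q).

Lemma sharp_core_hom X s : s ∈ X ⊙ P ⟶ P ⊙ X ->
  sharp_core X s ∈ X ⟶ P ⊙ X ⊙ Q.
Proof. by move=> hs; rewrite /sharp_core; hom. Qed.

Lemma flat_core_hom X t : t ∈ P ⊙ X ⟶ X ⊙ P ->
  flat_core X t ∈ P ⊙ X ⊙ Q ⟶ X.
Proof. by move=> ht; rewrite /flat_core; hom. Qed.

Lemma sharp_hom X s : s ∈ X ⊙ P ⟶ P ⊙ X -> sharp X s ∈ Q ⊙ X ⟶ X ⊙ Q.
Proof. by move=> hs; rewrite /sharp; hom. Qed.

Lemma flat_hom X t : t ∈ P ⊙ X ⟶ X ⊙ P -> flat X t ∈ X ⊙ Q ⟶ Q ⊙ X.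
Proof. by move=> ht; rewrite /flat; hom. Qed.

Lemma sharpE X s : s ∈ X ⊙ P ⟶ P ⊙ X ->
  sharp X s = (ev pp ⊗ X ⊗ Q) ∘ (Q ⊗ sharp_core X s).
Proof.
move=> hs; rewrite /sharp /sharp_core.
rewrite (whiskl _ (X := X) (Y := X ⊙ P ⊙ Q) (Z := P ⊙ X ⊙ Q)); [|hom|hom].
rewrite (comp3A (W := Q ⊙ X) (X := Q ⊙ X ⊙ P ⊙ Q) (Y := Q ⊙ P ⊙ X ⊙ Q)
  (Z := X ⊙ Q)); [|hom|hom|hom].
by rewrite !mtensA.
Qed.

Lemma flatE X t : t ∈ P ⊙ X ⟶ X ⊙ P ->
  flat X t = (Q ⊗ flat_core X t) ∘ (ucoev pp ⊗ X ⊗ Q).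
Proof.
move=> ht; rewrite /flat /flat_core.
rewrite (whiskl _ (X := P ⊙ X ⊙ Q) (Y := X ⊙ P ⊙ Q) (Z := X)); [|hom|hom].
by rewrite !mtensA.
Qed.

Lemma sharp_mate X s : s ∈ X ⊙ P ⟶ P ⊙ X ->
  (P ⊗ sharp X s) ∘ (coev pp ⊗ X) = sharp_core X s.
Proof.
move=> hs; have hc := sharp_core_hom hs.
rewrite sharpE //.
rewrite (whiskl _ (X := Q ⊙ X) (Y := Q ⊙ P ⊙ X ⊙ Q) (Z := X ⊙ Q)); [|hom|hom].
rewrite -(comp3A (W := X) (X := P ⊙ Q ⊙ X) (Y := P ⊙ Q ⊙ P ⊙ X ⊙ Q)
  (Z := P ⊙ X ⊙ Q)); [|hom|hom|hom].
have := slide (coev_hom pp) hc.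
rewrite mtens1l -!mtens_idm !mtensA => <-.
rewrite (comp3A (W := X) (X := P ⊙ X ⊙ Q) (Y := P ⊙ Q ⊙ P ⊙ X ⊙ Q)
  (Z := P ⊙ X ⊙ Q)); [|hom|hom|hom].
rewrite -!(mtensA _ X Q) (mtens_idm X Q)
  -(whiskr _ (X := P) (Y := P ⊙ Q ⊙ P) (Z := P)) ; [|hom|hom].
by rewrite zigzagP !mtens_idm otensA (compil hc).
Qed.

Lemma flat_mate X t : t ∈ P ⊙ X ⟶ X ⊙ P ->
  (uev pp ⊗ X) ∘ (P ⊗ flat X t) = flat_core X t.
Proof.
move=> ht; have hc := flat_core_hom ht.
rewrite flatE //.
rewrite (whiskl _ (X := X ⊙ Q) (Y := Q ⊙ P ⊙ X ⊙ Q) (Z := Q ⊙ X)); [|hom|hom].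
rewrite (comp3A (W := P ⊙ X ⊙ Q) (X := P ⊙ Q ⊙ P ⊙ X ⊙ Q) (Y := P ⊙ Q ⊙ X)
  (Z := X)); [|hom|hom|hom].
have := slide (uev_hom pp) hc.
rewrite mtens1l -!mtens_idm !mtensA => ->.
rewrite -(comp3A (W := P ⊙ X ⊙ Q) (X := P ⊙ Q ⊙ P ⊙ X ⊙ Q) (Y := P ⊙ X ⊙ Q)
  (Z := X)); [|hom|hom|hom].
rewrite -!(mtensA _ X Q) (mtens_idm X Q)
  -(whiskr _ (X := P) (Y := P ⊙ Q ⊙ P) (Z := P)) ; [|hom|hom].
by rewrite uzigzagP !mtens_idm otensA (compir hc).
Qed.

Lemma sharp_tens X s Y t : s ∈ X ⊙ P ⟶ P ⊙ X -> t ∈ Y ⊙ P ⟶ P ⊙ Y ->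
  sharp (X ⊙ Y) ((s ⊗ Y) ∘ (X ⊗ t)) = (X ⊗ sharp Y t) ∘ (sharp X s ⊗ Y).
Proof.
move=> hs ht.
have hS := sharp_core_hom hs; have hT := sharp_core_hom ht.
have hs' := sharp_hom hs; have ht' := sharp_hom ht.
have core : sharp_core (X ⊙ Y) ((s ⊗ Y) ∘ (X ⊗ t)) =
    (P ⊗ X ⊗ sharp Y t) ∘ (sharp_core X s ⊗ Y).
  rewrite {1}/sharp_core.
  rewrite (whiskr _ (X := X ⊙ Y ⊙ P) (Y := X ⊙ P ⊙ Y) (Z := P ⊙ X ⊙ Y));
    [|hom|hom].
  rewrite -(comp3A (W := X ⊙ Y) (X := X ⊙ Y ⊙ P ⊙ Q) (Y := X ⊙ P ⊙ Y ⊙ Q)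
    (Z := P ⊙ X ⊙ Y ⊙ Q)); [|hom|hom|hom].
  rewrite -mtens_idm -!(mtensA X).
  rewrite -(whiskl _ (X := Y) (Y := Y ⊙ P ⊙ Q) (Z := P ⊙ Y ⊙ Q)); [|hom|hom].
  rewrite -/(sharp_core Y t) -(sharp_mate ht).
  rewrite (whiskl _ (X := Y) (Y := P ⊙ Q ⊙ Y) (Z := P ⊙ Y ⊙ Q)); [|hom|hom].
  rewrite (comp3A (W := X ⊙ Y) (X := X ⊙ P ⊙ Q ⊙ Y) (Y := X ⊙ P ⊙ Y ⊙ Q)
    (Z := P ⊙ X ⊙ Y ⊙ Q)); [|hom|hom|hom].
  have := slide hs ht'; rewrite -!mtens_idm !mtensA => ->.
  rewrite /sharp_core (whiskr _ (X := X) (Y := X ⊙ P ⊙ Q) (Z := P ⊙ X ⊙ Q));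
    [|hom|hom].
  by rewrite (comp3A (W := X ⊙ Y) (X := X ⊙ P ⊙ Q ⊙ Y) (Y := P ⊙ X ⊙ Q ⊙ Y)
    (Z := P ⊙ X ⊙ Y ⊙ Q)); [|hom|hom|hom].
rewrite sharpE; last by hom.
rewrite core.
rewrite (whiskl _ (X := X ⊙ Y) (Y := P ⊙ X ⊙ Q ⊙ Y) (Z := P ⊙ X ⊙ Y ⊙ Q));
  [|hom|hom].
rewrite (comp3A (W := Q ⊙ X ⊙ Y) (X := Q ⊙ P ⊙ X ⊙ Q ⊙ Y)
  (Y := Q ⊙ P ⊙ X ⊙ Y ⊙ Q) (Z := X ⊙ Y ⊙ Q)); [|hom|hom|hom].
have hXt : X ⊗ sharp Y t ∈ X ⊙ Q ⊙ Y ⟶ X ⊙ Y ⊙ Q by hom.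
have := slide (ev_hom pp) hXt; rewrite mtens1l -!mtens_idm !mtensA => ->.
rewrite -(comp3A (W := Q ⊙ X ⊙ Y) (X := Q ⊙ P ⊙ X ⊙ Q ⊙ Y)
  (Y := X ⊙ Q ⊙ Y) (Z := X ⊙ Y ⊙ Q)); [|hom|hom|hom].
rewrite -(whiskr _ (X := Q ⊙ X) (Y := Q ⊙ P ⊙ X ⊙ Q) (Z := X ⊙ Q)); [|hom|hom].
by rewrite (sharpE hs).
Qed.

Lemma flat_tens X s Y t : s ∈ P ⊙ X ⟶ X ⊙ P -> t ∈ P ⊙ Y ⟶ Y ⊙ P ->
  flat (X ⊙ Y) ((X ⊗ t) ∘ (s ⊗ Y)) = (flat X s ⊗ Y) ∘ (X ⊗ flat Y t).
Proof.
move=> hs ht.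
have hS := flat_core_hom hs; have hT := flat_core_hom ht.
have hs' := flat_hom hs; have ht' := flat_hom ht.
have core : flat_core (X ⊙ Y) ((X ⊗ t) ∘ (s ⊗ Y)) =
    (flat_core X s ⊗ Y) ∘ (P ⊗ X ⊗ flat Y t).
  rewrite {1}/flat_core.
  rewrite (whiskr _ (X := P ⊙ X ⊙ Y) (Y := X ⊙ P ⊙ Y) (Z := X ⊙ Y ⊙ P));
    [|hom|hom].
  rewrite (comp3A (W := P ⊙ X ⊙ Y ⊙ Q) (X := X ⊙ P ⊙ Y ⊙ Q)
    (Y := X ⊙ Y ⊙ P ⊙ Q) (Z := X ⊙ Y)); [|hom|hom|hom].
  rewrite -mtens_idm -!(mtensA X).
  rewrite -(whiskl _ (X := P ⊙ Y ⊙ Q) (Y := Y ⊙ P ⊙ Q) (Z := Y)); [|hom|hom].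
  rewrite -/(flat_core Y t) -(flat_mate ht).
  rewrite (whiskl _ (X := P ⊙ Y ⊙ Q) (Y := P ⊙ Q ⊙ Y) (Z := Y)); [|hom|hom].
  rewrite -(comp3A (W := P ⊙ X ⊙ Y ⊙ Q) (X := X ⊙ P ⊙ Y ⊙ Q)
    (Y := X ⊙ P ⊙ Q ⊙ Y) (Z := X ⊙ Y)); [|hom|hom|hom].
  have := slide hs ht'; rewrite -!mtens_idm !mtensA => <-.
  rewrite /flat_core (whiskr _ (X := P ⊙ X ⊙ Q) (Y := X ⊙ P ⊙ Q) (Z := X));
    [|hom|hom].
  by rewrite (comp3A (W := P ⊙ X ⊙ Y ⊙ Q) (X := P ⊙ X ⊙ Q ⊙ Y)
    (Y := X ⊙ P ⊙ Q ⊙ Y) (Z := X ⊙ Y)); [|hom|hom|hom].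
rewrite flatE; last by hom.
rewrite core.
rewrite (whiskl _ (X := P ⊙ X ⊙ Y ⊙ Q) (Y := P ⊙ X ⊙ Q ⊙ Y) (Z := X ⊙ Y));
  [|hom|hom].
rewrite -(comp3A (W := X ⊙ Y ⊙ Q) (X := Q ⊙ P ⊙ X ⊙ Y ⊙ Q)
  (Y := Q ⊙ P ⊙ X ⊙ Q ⊙ Y) (Z := Q ⊙ X ⊙ Y)); [|hom|hom|hom].
have hXt : X ⊗ flat Y t ∈ X ⊙ Y ⊙ Q ⟶ X ⊙ Q ⊙ Y by hom.
have := slide (ucoev_hom pp) hXt; rewrite mtens1l -!mtens_idm !mtensA => <-.
rewrite (comp3A (W := X ⊙ Y ⊙ Q) (X := X ⊙ Q ⊙ Y)
  (Y := Q ⊙ P ⊙ X ⊙ Q ⊙ Y) (Z := Q ⊙ X ⊙ Y)); [|hom|hom|hom].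
rewrite -(whiskr _ (X := X ⊙ Q) (Y := Q ⊙ P ⊙ X ⊙ Q) (Z := Q ⊙ X)); [|hom|hom].
by rewrite (flatE hs).
Qed.

Lemma pq_axiom_tens X s Y t : pq_axiom X s -> pq_axiom Y t ->
  pq_axiom (X ⊙ Y) ((s ⊗ Y) ∘ (X ⊗ t)).
Proof.
move=> [s' [is_ js]] [t' [it jt]].
have [hs hs' _ _] := is_; have [ht ht' _ _] := it.
exists ((X ⊗ t') ∘ (s' ⊗ Y)); split.
  have := inverse_pair_comp (inverse_pair_tens (inverse_pair_id X) it)
    (Z := P ⊙ X ⊙ Y) (g := s ⊗ Y) (g' := s' ⊗ Y).
  rewrite !otensA; apply.
  exact: inverse_pair_tens is_ (inverse_pair_id Y).
rewrite sharp_tens // flat_tens //.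
have := inverse_pair_comp (inverse_pair_tens js (inverse_pair_id Y))
  (Z := X ⊙ Y ⊙ Q) (g := X ⊗ sharp Y t) (g' := X ⊗ flat Y t').
rewrite !otensA; apply.
have := inverse_pair_tens (inverse_pair_id X) jt.
by rewrite !otensA.
Qed.

Lemma pq_axiom_one : pq_axiom one P.
Proof.
have e : sharp one P = Q.
  rewrite /sharp !mtens1r.
  have h : Q ⊗ coev pp ∈ Q ⟶ Q ⊙ P ⊙ Q by hom.
  rewrite !mtens_idm -(comp3A (W := Q) (X := Q ⊙ P ⊙ Q) (Y := Q ⊙ P ⊙ Q)
    (Z := Q)); [|hom|hom|hom].
  by rewrite (compil h) zigzagQ.
have e' : flat one P = Q.
  rewrite /flat !mtens1r.
  have h : ucoev pp ⊗ Q ∈ Q ⟶ Q ⊙ P ⊙ Q by hom.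
  rewrite !mtens_idm -(comp3A (W := Q) (X := Q ⊙ P ⊙ Q) (Y := Q ⊙ P ⊙ Q)
    (Z := Q)); [|hom|hom|hom].
  by rewrite (compil h) uzigzagQ.
exists P; rewrite e e' !otens1l !otens1r; split; exact: inverse_pair_id.
Qed.

Record pq_ob := PQOb {
  pq_carrier : ob C;
  pq_sigma : mor C;
  pq_obP : pq_axiom pq_carrier pq_sigma
}.

(* A morphism (X, s) -> (Y, t): the underlying morphism of C together with its
   source and target in C(P,Q). *)
Record pq_mor := PQMor {
  pq_dom : pq_ob;
  pq_cod : pq_ob;
  pq_und : mor C;
  pq_und_hom : pq_und ∈ pq_carrier pq_dom ⟶ pq_carrier pq_cod;
  pq_und_comm : pq_sigma pq_cod ∘ (pq_und ⊗ P) = (P ⊗ pq_und) ∘ pq_sigma pq_dom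
}.

Lemma pq_ob_eq (A B : pq_ob) :
  pq_carrier A = pq_carrier B -> pq_sigma A = pq_sigma B -> A = B.
Proof.
case: A B => [X s p] [Y t q] /= eX es; rewrite -eX -es in q *.
by rewrite (Prop_irrelevance p q).
Qed.

Lemma pq_mor_eq (f g : pq_mor) : pq_dom f = pq_dom g -> pq_cod f = pq_cod g ->
  pq_und f = pq_und g -> f = g.
Proof.
case: f g => [A B f p q] [A' B' g p' q'] /= eA eB e.
rewrite -eA -eB -e in p' q' *.
by rewrite (Prop_irrelevance p p') (Prop_irrelevance q q').
Qed.

Lemma pq_sigma_hom (A : pq_ob) :
  pq_sigma A ∈ pq_carrier A ⊙ P ⟶ P ⊙ pq_carrier A.
Proof. by case: (pq_obP A) => ? [[]]. Qed.

#[local] Hint Resolve pq_sigma_hom pq_und_hom : cathom.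

Lemma pq_id_comm (A : pq_ob) :
  pq_sigma A ∘ (pq_carrier A ⊗ P) = (P ⊗ pq_carrier A) ∘ pq_sigma A.
Proof.
by rewrite !mtens_idm (compir (pq_sigma_hom A)) (compil (pq_sigma_hom A)).
Qed.

Definition pq_idm (A : pq_ob) : pq_mor := PQMor (hom_idm _) (pq_id_comm A).

Section Comp.
Variables (g f : pq_mor) (e : pq_cod f = pq_dom g).

Lemma pq_comp_hom :
  pq_und g ∘ pq_und f ∈ pq_carrier (pq_dom f) ⟶ pq_carrier (pq_cod g).
Proof.
apply: (hom_comp (pq_und_hom f)); rewrite e; exact: pq_und_hom.
Qed.

Lemma pq_comp_comm :
  pq_sigma (pq_cod g) ∘ ((pq_und g ∘ pq_und f) ⊗ P) =
  (P ⊗ (pq_und g ∘ pq_und f)) ∘ pq_sigma (pq_dom f).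
Proof.
have hf := pq_und_hom f; rewrite e in hf.
have cf := pq_und_comm f; rewrite e in cf.
have hg := pq_und_hom g; have cg := pq_und_comm g.
have sA := pq_sigma_hom (pq_dom f); have sB := pq_sigma_hom (pq_dom g).
have sC := pq_sigma_hom (pq_cod g).
set X := pq_carrier (pq_dom f) in hf cf sA *.
set Y := pq_carrier (pq_dom g) in hf hg sB.
set Z := pq_carrier (pq_cod g) in hg sC.
rewrite (whiskr P hf hg) (whiskl P hf hg).
rewrite (comp3A (W := X ⊙ P) (X := Y ⊙ P) (Y := Z ⊙ P) (Z := P ⊙ Z));
  [|hom|hom|hom].
rewrite cg -(comp3A (W := X ⊙ P) (X := Y ⊙ P) (Y := P ⊙ Y) (Z := P ⊙ Z));
  [|hom|hom|hom].
by rewrite cf (comp3A (W := X ⊙ P) (X := P ⊙ X) (Y := P ⊙ Y) (Z := P ⊙ Z));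
  [|hom|hom|hom].
Qed.

Definition pq_comp_def : pq_mor := PQMor pq_comp_hom pq_comp_comm.

End Comp.

(* On non-composable pairs the value is a placeholder. *)
Definition pq_comp (g f : pq_mor) : pq_mor :=
  match pselect (pq_cod f = pq_dom g) with
  | left e => pq_comp_def e
  | right _ => f
  end.

Lemma pq_compE g f (e : pq_cod f = pq_dom g) : pq_comp g f = pq_comp_def e.
Proof.
by rewrite /pq_comp; case: pselect => // e'; rewrite (Prop_irrelevance e e').
Qed.

Lemma pq_und_comp g f : pq_cod f = pq_dom g ->
  pq_und (pq_comp g f) = pq_und g ∘ pq_und f.
Proof. by move=> e; rewrite (pq_compE e). Qed.

Lemma pq_dom_comp g f : pq_cod f = pq_dom g -> pq_dom (pq_comp g f) = pq_dom f.
Proof. by move=> e; rewrite (pq_compE e). Qed.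

Lemma pq_cod_comp g f : pq_cod f = pq_dom g -> pq_cod (pq_comp g f) = pq_cod g.
Proof. by move=> e; rewrite (pq_compE e). Qed.

Lemma pq_comp_idl f : pq_comp (pq_idm (pq_cod f)) f = f.
Proof.
apply: pq_mor_eq; rewrite ?pq_dom_comp ?pq_cod_comp ?pq_und_comp //=.
exact: compil (pq_und_hom f).
Qed.

Lemma pq_comp_idr f : pq_comp f (pq_idm (pq_dom f)) = f.
Proof.
apply: pq_mor_eq; rewrite ?pq_dom_comp ?pq_cod_comp ?pq_und_comp //=.
exact: compir (pq_und_hom f).
Qed.

Lemma pq_compA h g f : pq_cod f = pq_dom g -> pq_cod g = pq_dom h ->
  pq_comp h (pq_comp g f) = pq_comp (pq_comp h g) f.
Proof.
move=> e e'.
have e1 : pq_cod (pq_comp g f) = pq_dom h by rewrite pq_cod_comp.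
have e2 : pq_cod f = pq_dom (pq_comp h g) by rewrite pq_dom_comp.
apply: pq_mor_eq; rewrite ?(pq_dom_comp e1, pq_dom_comp e2, pq_cod_comp e1,
  pq_cod_comp e2, pq_und_comp e1, pq_und_comp e2) ?pq_dom_comp ?pq_cod_comp
  ?pq_und_comp //.
have hg := pq_und_hom g; have hh := pq_und_hom h; rewrite -e in hg.
rewrite -e' in hh; exact: comp3A (pq_und_hom f) hg hh.
Qed.

Definition pq_category : category :=
  @Category pq_ob pq_mor pq_dom pq_cod pq_idm pq_comp
    (fun _ => erefl) (fun _ => erefl) pq_dom_comp pq_cod_comp
    pq_comp_idl pq_comp_idr pq_compA.

Definition pq_one : pq_ob := PQOb pq_axiom_one.

Definition pq_otens (A B : pq_ob) : pq_ob :=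
  PQOb (pq_axiom_tens (pq_obP A) (pq_obP B)).

Lemma pq_mtens_comm (f g : pq_mor) :
  pq_sigma (pq_otens (pq_cod f) (pq_cod g)) ∘ (pq_und f ⊗ pq_und g ⊗ P) =
  (P ⊗ (pq_und f ⊗ pq_und g)) ∘ pq_sigma (pq_otens (pq_dom f) (pq_dom g)).
Proof.
have hf := pq_und_hom f; have cf := pq_und_comm f.
have hg := pq_und_hom g; have cg := pq_und_comm g.
have sA := pq_sigma_hom (pq_dom f); have sA' := pq_sigma_hom (pq_cod f).
have sB := pq_sigma_hom (pq_dom g); have sB' := pq_sigma_hom (pq_cod g).
rewrite /=.
set X := pq_carrier (pq_dom f) in hf sA *.
set X' := pq_carrier (pq_cod f) in hf sA' *.
set Y := pq_carrier (pq_dom g) in hg sB *.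
set Y' := pq_carrier (pq_cod g) in hg sB' *.
rewrite -(comp3A (W := X ⊙ Y ⊙ P) (X := X' ⊙ Y' ⊙ P) (Y := X' ⊙ P ⊙ Y')
  (Z := P ⊙ X' ⊙ Y')); [|hom|hom|hom].
rewrite -(mtensA (pq_und f)) -(tens_comp (X := X) (Y := X') (Z := X')
  (X' := Y ⊙ P) (Y' := Y' ⊙ P) (Z' := P ⊙ Y')); [|hom|hom|hom|hom].
rewrite cg (compil hf) -{1}(compir hf).
rewrite (tens_comp (X := X) (Y := X) (Z := X')
  (X' := Y ⊙ P) (Y' := P ⊙ Y) (Z' := P ⊙ Y')); [|hom|hom|hom|hom].
rewrite (comp3A (W := X ⊙ Y ⊙ P) (X := X ⊙ P ⊙ Y) (Y := X' ⊙ P ⊙ Y')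
  (Z := P ⊙ X' ⊙ Y')); [|hom|hom|hom].
rewrite mtensA -(tens_comp (X := X ⊙ P) (Y := X' ⊙ P) (Z := P ⊙ X')
  (X' := Y) (Y' := Y') (Z' := Y')); [|hom|hom|hom|hom].
rewrite cf (compil hg) -{1}(compir hg).
rewrite (tens_comp (X := X ⊙ P) (Y := P ⊙ X) (Z := P ⊙ X')
  (X' := Y) (Y' := Y) (Z' := Y')); [|hom|hom|hom|hom].
by rewrite mtensA (comp3A (W := X ⊙ Y ⊙ P) (X := X ⊙ P ⊙ Y) (Y := P ⊙ X ⊙ Y)
  (Z := P ⊙ X' ⊙ Y')); [|hom|hom|hom].
Qed.

Definition pq_mtens (f g : pq_mor) : pq_mor :=
  @PQMor (pq_otens (pq_dom f) (pq_dom g)) (pq_otens (pq_cod f) (pq_cod g))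
    (pq_und f ⊗ pq_und g) (hom_tens (pq_und_hom f) (pq_und_hom g))
    (pq_mtens_comm f g).

Lemma pq_otensA (A B D : pq_ob) :
  pq_otens A (pq_otens B D) = pq_otens (pq_otens A B) D.
Proof.
have sA := pq_sigma_hom A; have sB := pq_sigma_hom B.
have sD := pq_sigma_hom D.
apply: pq_ob_eq => /=; first exact: otensA.
set X := pq_carrier A in sA *; set Y := pq_carrier B in sB *.
set Z := pq_carrier D in sD *.
rewrite (whiskl _ (X := Y ⊙ Z ⊙ P) (Y := Y ⊙ P ⊙ Z) (Z := P ⊙ Y ⊙ Z)); [|hom|hom].
rewrite (whiskr _ (X := X ⊙ Y ⊙ P) (Y := X ⊙ P ⊙ Y) (Z := P ⊙ X ⊙ Y)); [|hom|hom].
rewrite (comp3A (W := X ⊙ Y ⊙ Z ⊙ P) (X := X ⊙ Y ⊙ P ⊙ Z)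
  (Y := X ⊙ P ⊙ Y ⊙ Z) (Z := P ⊙ X ⊙ Y ⊙ Z)); [|hom|hom|hom].
by rewrite -!mtens_idm !mtensA.
Qed.

Lemma pq_otens1l A : pq_otens pq_one A = A.
Proof.
apply: pq_ob_eq => /=; first exact: otens1l.
by rewrite mtens1l mtens_idm (compil (pq_sigma_hom A)).
Qed.

Lemma pq_otens1r A : pq_otens A pq_one = A.
Proof.
apply: pq_ob_eq => /=; first exact: otens1r.
by rewrite mtens1r mtens_idm (compir (pq_sigma_hom A)).
Qed.

Lemma pq_mtens_idm (A B : pq_ob) : pq_mtens (pq_idm A) (pq_idm B) = pq_idm (pq_otens A B).
Proof. by apply: pq_mor_eq => //=; rewrite mtens_idm. Qed.

Lemma pq_interchange g f g' f' : pq_cod f = pq_dom g -> pq_cod f' = pq_dom g' ->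
  pq_mtens (pq_comp g f) (pq_comp g' f') =
  pq_comp (pq_mtens g g') (pq_mtens f f').
Proof.
move=> e e'.
have E : pq_cod (pq_mtens f f') = pq_dom (pq_mtens g g') by rewrite /= e e'.
apply: pq_mor_eq; rewrite ?(pq_dom_comp E) ?(pq_cod_comp E) ?(pq_und_comp E) /=.
- by rewrite !pq_dom_comp.
- by rewrite !pq_cod_comp.
rewrite !pq_und_comp //.
have hg := pq_und_hom g; have hg' := pq_und_hom g'.
rewrite -e in hg; rewrite -e' in hg'.
exact: tens_comp (pq_und_hom f) hg (pq_und_hom f') hg'.
Qed.

Lemma pq_mtensA f g h : pq_mtens f (pq_mtens g h) = pq_mtens (pq_mtens f g) h.
Proof. by apply: pq_mor_eq; rewrite /= ?pq_otensA ?mtensA. Qed.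

Lemma pq_mtens1l f : pq_mtens (pq_idm pq_one) f = f.
Proof. by apply: pq_mor_eq; rewrite /= ?pq_otens1l ?mtens1l. Qed.

Lemma pq_mtens1r f : pq_mtens f (pq_idm pq_one) = f.
Proof. by apply: pq_mor_eq; rewrite /= ?pq_otens1r ?mtens1r. Qed.

(* The monoidal category C(P,Q). *)
Definition pq_monoidal : monoidal :=
  @Monoidal pq_category pq_one pq_otens pq_mtens
    (fun _ _ => erefl) (fun _ _ => erefl) pq_mtens_idm pq_interchange
    pq_otensA pq_otens1l pq_otens1r pq_mtensA pq_mtens1l pq_mtens1r.

Lemma pq_und_dom (f : mor pq_monoidal) : dom (pq_und f) = pq_carrier (dom f).
Proof. by case: (pq_und_hom f). Qed.

Lemma pq_und_cod (f : mor pq_monoidal) : cod (pq_und f) = pq_carrier (cod f).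
Proof. by case: (pq_und_hom f). Qed.

Definition forget_functor : functor pq_monoidal C :=
  @Functor pq_monoidal C pq_carrier pq_und pq_und_dom pq_und_cod
    (fun _ => erefl) pq_und_comp.

(* The strict monoidal functor U : C(P,Q) -> C: its structure morphisms are
   identities. *)
Definition forget : monoidal_functor pq_monoidal C.
Proof.
refine (@MonoidalFunctor pq_monoidal C forget_functor
  (fun A B => idm (pq_carrier A ⊙ pq_carrier B)) (idm one) _ _ _ _ _ _).
- by move=> A B; exact: hom_idm.
- exact: hom_idm.
- move=> f g /=.
  have h := hom_tens (pq_und_hom f) (pq_und_hom g).
  by rewrite (compil h) (compir h).
- by move=> A B D /=; rewrite !mtens_idm otensA.
- by move=> A /=; rewrite mtens_idm otens1l (compil (hom_idm _)).
- by move=> A /=; rewrite mtens_idm otens1r (compil (hom_idm _)).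
Defined.

End Lifting.

(* Main.v *)
From mathcomp Require Import ssreflect ssrfun ssrbool.
From mathcomp Require Import boolp.
Require Import Defs.

(** Let H = [X, Y] with evaluation e : X ⊗ H -> Y, where X and Y carry
    structures a and y of objects of C(P,Q).  An evaluation is a universal arrow
    out of X ⊗ -, and universal arrows are stable under the operations that a
    pivotal pair provides:
    - e ⊗ P and e ⊗ Q are universal, because - ⊗ P and - ⊗ Q have left adjoints
      that commute with X ⊗ - ([universal_tensor_right]);
    - (P ⊗ e)(a ⊗ H) is universal, because P ⊗ - has the left adjoint Q ⊗ - and
      the mate Q ⊗ X -> X ⊗ Q of a, which is its sharp, is invertible.  With the
      two roles exchanged, (Q ⊗ e)(flat a^-1 ⊗ H) is universal, the mate of
      flat a^-1 being the invertible a^-1 ([universal_tensor_left]).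

    So P ⊗ H and H ⊗ P both represent internal homs, and the structure s on H
    is forced: it is the only solution of
      y (e ⊗ P) = (P ⊗ e) (a ⊗ H) (X ⊗ s),
    which says that e is a morphism of C(P,Q).  Solving the same equation for the
    other universal arrow gives the inverse of s.  As sharp and flat are natural
    and multiplicative, the sharp of s and the flat of s^-1 satisfy analogous
    equations for the two universal arrows with Q, and are therefore inverse to
    each other ([hom_structure_exists]).

    Uniqueness also shows that the transpose of a morphism of C(P,Q) is again
    one ([hom_structure_commutes]).  Hence the units and the action of [X, -] on
    morphisms lift, and the adjunction laws hold because they hold in C.  The
    comparison morphism of the forgetful functor is then an identity, by a
    triangle law. *)

Set Implicit Arguments.
Unset Strict Implicit.
Unset Printing Implicit Defensive.
Local Open Scope cat_scope.

(** * Typing side conditions *)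

#[local] Hint Resolve coev_hom ev_hom ucoev_hom uev_hom : cathom.
#[local] Hint Resolve pq_sigma_hom pq_und_hom : cathom.

Lemma hom_composable (C : category) (X Y Y' Z : ob C) (f g : mor C) :
  f ∈ X ⟶ Y -> g ∈ Y' ⟶ Z -> Y = Y' -> cod f = dom g.
Proof. by move=> [_ ->] [-> _]. Qed.

Ltac composable := eapply hom_composable; [hom_infer | hom_infer | objeq].
(* Identities of tensor products are split and tensors associated to the left, so
   that equal whiskered morphisms become syntactically equal. *)
Ltac flatten := rewrite -?mtens_idm ?mtensA.

(** * Universal arrows and duality *)

Section Universal.
Variable C : monoidal.
Implicit Types (A L R X Y Z W H : ob C) (f g h k u : mor C).

Lemma tensor_right_comp A g f : cod f = dom g -> (g ∘ f) ⊗ A = (g ⊗ A) ∘ (f ⊗ A).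
Proof. by move=> e; rewrite (whiskr A (conj erefl e) (conj erefl erefl)). Qed.

(** Equivalently L ⊗ - ⊣ R ⊗ -, and also - ⊗ R ⊣ - ⊗ L, with unit and counit
    given by tensoring with eta and eps. *)
Record duality L R (eta eps : mor C) : Prop := Duality {
  eta_hom : eta ∈ one ⟶ R ⊙ L;
  eps_hom : eps ∈ L ⊙ R ⟶ one;
  dualL : (eps ⊗ L) ∘ (L ⊗ eta) = L;
  dualR : (R ⊗ eps) ∘ (eta ⊗ R) = R
}.

(** Says that u exhibits Z as an internal hom from A to Y.  Stated for a single
    Y, so that it applies to P ⊗ Z and Z ⊗ P without choosing a right adjoint. *)
Record universal A Z Y u : Prop := Universal {
  univ_hom : u ∈ A ⊙ Z ⟶ Y;
  univ_ex : forall W g, g ∈ A ⊙ W ⟶ Y ->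
    exists2 h, h ∈ W ⟶ Z & u ∘ (A ⊗ h) = g;
  univ_eq : forall W h h', h ∈ W ⟶ Z -> h' ∈ W ⟶ Z ->
    u ∘ (A ⊗ h) = u ∘ (A ⊗ h') -> h = h'
}.

Section Duality.
Variables (L R : ob C) (eta eps : mor C).
Hypothesis D : duality L R eta eps.

Let heta : eta ∈ one ⟶ R ⊙ L := eta_hom D.
Let heps : eps ∈ L ⊙ R ⟶ one := eps_hom D.

(** The triangle law for - ⊗ R ⊣ - ⊗ L. *)
Lemma untranspose_transpose_right W H h : h ∈ W ⟶ H ⊙ L ->
  (((H ⊗ eps) ∘ (h ⊗ R)) ⊗ L) ∘ (W ⊗ eta) = h.
Proof.
move=> hh; rewrite tensor_right_comp; last by composable.
rewrite -compA; [|composable|composable].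
have := slide hh heta; rewrite mtens1r; flatten => ->.
rewrite compA; [|composable|composable].
rewrite -!mtensA -tensor_left_comp; last by composable.
by rewrite (dualL D) mtens_idm (compil hh).
Qed.

(** The triangle law on the right adjoint side of L ⊗ - ⊣ R ⊗ -. *)
Lemma untranspose_transpose_left W H h : h ∈ W ⟶ R ⊙ H ->
  (R ⊗ ((eps ⊗ H) ∘ (L ⊗ h))) ∘ (eta ⊗ W) = h.
Proof.
move=> hh; rewrite tensor_left_comp; last by composable.
rewrite -compA; [|composable|composable].
have := slide heta hh; rewrite mtens1l; flatten => <-.
rewrite compA; [|composable|composable].
rewrite -tensor_right_comp; last by composable.
by rewrite (dualR D) mtens_idm (compil hh).
Qed.

(** The triangle law on the left adjoint side of L ⊗ - ⊣ R ⊗ -. *)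
Lemma transpose_untranspose_left Y X f : f ∈ L ⊙ Y ⟶ X ->
  (eps ⊗ X) ∘ (L ⊗ ((R ⊗ f) ∘ (eta ⊗ Y))) = f.
Proof.
move=> hf; rewrite tensor_left_comp; last by composable.
rewrite compA; [|composable|composable].
have := slide heps hf; rewrite mtens1l; flatten => ->.
rewrite -compA; [|composable|composable].
rewrite -tensor_right_comp; last by composable.
by rewrite (dualL D) mtens_idm (compir hf).
Qed.

(** Morphisms A ⊗ W -> Y ⊗ L correspond to morphisms A ⊗ W ⊗ R -> Y, hence to
    W ⊗ R -> Z, hence to W -> Z ⊗ L; the composite correspondence is h ↦
    (u ⊗ L)(A ⊗ h). *)
Lemma universal_tensor_right A Z Y u :
  universal A Z Y u -> universal A (Z ⊙ L) (Y ⊙ L) (u ⊗ L).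
Proof.
move=> U; have hu := univ_hom U; split; first by hom.
- move=> W g hg.
  have hg' : (Y ⊗ eps) ∘ (g ⊗ R) ∈ A ⊙ (W ⊙ R) ⟶ Y by hom.
  have [k hk ek] := univ_ex U hg'.
  exists ((k ⊗ L) ∘ (W ⊗ eta)); first by hom.
  rewrite tensor_left_comp; last by composable.
  rewrite compA; [|composable|composable].
  rewrite mtensA -tensor_right_comp; last by composable.
  rewrite ek -[RHS](untranspose_transpose_right hg).
  by flatten.
move=> W h h' hh hh' e.
(* The transpose of i evaluates to the transpose of (u ⊗ L)(A ⊗ i). *)
have t i : i ∈ W ⟶ Z ⊙ L -> u ∘ (A ⊗ ((Z ⊗ eps) ∘ (i ⊗ R))) =
    (Y ⊗ eps) ∘ (((u ⊗ L) ∘ (A ⊗ i)) ⊗ R).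
  move=> hi; rewrite tensor_left_comp; last by composable.
  rewrite tensor_right_comp; last by composable.
  rewrite compA; [|composable|composable].
  rewrite compA; [|composable|composable].
  have := slide hu heps; rewrite mtens1r; flatten => ->.
  by [].
rewrite -(untranspose_transpose_right hh) -(untranspose_transpose_right hh').
congr (_ ⊗ _ ∘ _); apply: (univ_eq U (W := W ⊙ R)); [hom|hom|].
by rewrite !t // e.
Qed.

(** Morphisms A ⊗ W -> R ⊗ Y correspond to morphisms L ⊗ A ⊗ W -> Y, hence along
    the invertible mate m : L ⊗ A -> A ⊗ L of b to A ⊗ L ⊗ W -> Y, hence to
    L ⊗ W -> Z, hence to W -> R ⊗ Z.  The third premise says that m is the mate
    of b under L ⊗ - ⊣ R ⊗ -. *)
Lemma universal_tensor_left A b m m' Z Y u :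
  b ∈ A ⊙ R ⟶ R ⊙ A -> inverse_pair (L ⊙ A) (A ⊙ L) m m' ->
  (R ⊗ m) ∘ (eta ⊗ A) = (b ⊗ L) ∘ (A ⊗ eta) ->
  universal A Z Y u -> universal A (R ⊙ Z) (R ⊙ Y) ((R ⊗ u) ∘ (b ⊗ Z)).
Proof.
move=> hb [hm hm' m'm mm'] mate U; have hu := univ_hom U.
(* Under the transposition k ↦ (R ⊗ k)(eta ⊗ W), composing with the new arrow
   becomes composing with u and the mate. *)
have key W k : k ∈ L ⊙ W ⟶ Z ->
    (R ⊗ u) ∘ (b ⊗ Z) ∘ (A ⊗ ((R ⊗ k) ∘ (eta ⊗ W))) =
    (R ⊗ (u ∘ (A ⊗ k) ∘ (m ⊗ W))) ∘ (eta ⊗ A ⊗ W).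
  move=> hk.
  rewrite !tensor_left_comp; [|composable|composable|composable].
  rewrite compA; [|composable|composable].
  rewrite -(@compA _ (R ⊗ u) (b ⊗ Z)); [|composable|composable].
  have := slide hb hk; flatten => ->.
  rewrite compA; [|composable|composable].
  rewrite -compA; [|composable|composable].
  rewrite -tensor_right_comp; last by composable.
  rewrite -mate tensor_right_comp; last by composable.
  by rewrite compA; [|composable|composable].
split; first by hom.
- move=> W g hg.
  have hg' : (eps ⊗ Y) ∘ (L ⊗ g) ∘ (m' ⊗ W) ∈ A ⊙ (L ⊙ W) ⟶ Y by hom.
  have [k hk ek] := univ_ex U hg'.
  exists ((R ⊗ k) ∘ (eta ⊗ W)); first by hom.
  rewrite key // ek -(@compA _ _ (m' ⊗ W)); [|composable|composable].
  rewrite -tensor_right_comp; last by composable.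
  have hg2 : (eps ⊗ Y) ∘ (L ⊗ g) ∈ L ⊙ A ⊙ W ⟶ Y by hom.
  rewrite m'm mtens_idm (compir hg2) -[RHS](untranspose_transpose_left hg).
  by flatten.
move=> W h h' hh hh'.
rewrite -(untranspose_transpose_left hh) -(untranspose_transpose_left hh').
have hk : (eps ⊗ Z) ∘ (L ⊗ h) ∈ L ⊙ W ⟶ Z by hom.
have hk' : (eps ⊗ Z) ∘ (L ⊗ h') ∈ L ⊙ W ⟶ Z by hom.
set k := _ ∘ (L ⊗ h) in hk *; set k' := _ ∘ (L ⊗ h') in hk' *.
rewrite !key //.
have hf i : i ∈ L ⊙ W ⟶ Z -> u ∘ (A ⊗ i) ∘ (m ⊗ W) ∈ L ⊙ (A ⊙ W) ⟶ Y.
  by move=> hi; hom.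
move=> e.
have {}e : u ∘ (A ⊗ k) ∘ (m ⊗ W) = u ∘ (A ⊗ k') ∘ (m ⊗ W).
  rewrite -(transpose_untranspose_left (hf _ hk)).
  rewrite -(transpose_untranspose_left (hf _ hk')).
  by move: e; flatten => ->.
congr (_ ⊗ _ ∘ _); apply: (univ_eq U hk hk').
have cancel i : i ∈ L ⊙ W ⟶ Z ->
    u ∘ (A ⊗ i) = u ∘ (A ⊗ i) ∘ (m ⊗ W) ∘ (m' ⊗ W).
  move=> hi; rewrite -(@compA _ _ (m ⊗ W)); [|composable|composable].
  rewrite -tensor_right_comp; last by composable.
  have hui : u ∘ (A ⊗ i) ∈ A ⊙ L ⊙ W ⟶ Y by hom.
  by rewrite mm' mtens_idm (compir hui).
by rewrite (cancel k) // e -cancel.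
Qed.

End Duality.

Lemma universal_counit A (G : functor C C) (adj : adjunction (tensor_left A) G) Y :
  universal A (fob G Y) Y (adj_counit adj Y).
Proof.
have he := adj_counit_hom adj Y; split => //.
- move=> W g hg; have [dg cg] := hg.
  have hn := adj_unit_hom adj W.
  have hGg : fmor G g ∈ fob G (A ⊙ W) ⟶ fob G Y.
    by split; rewrite ?dom_fmor ?cod_fmor ?dg ?cg.
  exists (fmor G g ∘ adj_unit adj W); first exact: hom_comp hn hGg.
  have hc := adj_counit_hom adj (A ⊙ W).
  rewrite /= in he hn hc.
  rewrite tensor_left_comp; last by composable.
  rewrite compA; [|composable|composable].
  have := adj_counit_nat adj g; rewrite cg dg /= => ->.
  rewrite -compA; [|composable|composable].
  by have := triangleL adj W; rewrite /= => ->; rewrite (compir hg).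
move=> W h h' hh hh'.
have t i : i ∈ W ⟶ fob G Y ->
    i = fmor G (adj_counit adj Y ∘ (A ⊗ i)) ∘ adj_unit adj W.
  move=> hi; have [di ci] := hi; rewrite /= in he; have [de ce] := he.
  have hn := adj_unit_hom adj W; rewrite /= in hn.
  have hn' := adj_unit_hom adj (fob G Y); rewrite /= in hn'.
  have hGe : fmor G (adj_counit adj Y) ∈ fob G (A ⊙ fob G Y) ⟶ fob G Y.
    by split; rewrite ?dom_fmor ?cod_fmor ?de ?ce.
  have hGi : fmor G (A ⊗ i) ∈ fob G (A ⊙ W) ⟶ fob G (A ⊙ fob G Y).
    by split; rewrite ?dom_fmor ?cod_fmor ?dom_mtens ?cod_mtens
      ?dom_idm ?cod_idm ?di ?ci.
  rewrite fmor_comp; last by composable.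
  rewrite -compA; [|composable|composable].
  have := adj_unit_nat adj i; rewrite di ci /= => <-.
  rewrite compA; [|composable|composable].
  by have := triangleR adj Y; rewrite /= => ->; rewrite (compil hi).
by move=> e; rewrite (t h) // (t h') // e.
Qed.

End Universal.

(** * The structure carried by an internal hom *)

Section HomObject.
Variables (C : monoidal) (pp : pivotal_pair C).
Implicit Types (X Y W H : ob C) (f g h u s t : mor C).

Local Notation P := (pP pp).
Local Notation Q := (pQ pp).

Lemma duality_ev_coev : duality Q P (coev pp) (ev pp).
Proof.
by split; [exact: coev_hom | exact: ev_hom | exact: zigzagQ | exact: zigzagP].
Qed.

Lemma duality_uev_ucoev : duality P Q (ucoev pp) (uev pp).
Proof.
by split; [exact: ucoev_hom | exact: uev_hom | exact: uzigzagP | exact: uzigzagQ].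
Qed.

Lemma inverse_pair_sym X Y f g : inverse_pair X Y f g -> inverse_pair Y X g f.
Proof. by case. Qed.

Lemma sharp_natural X s Y t f :
  s ∈ X ⊙ P ⟶ P ⊙ X -> t ∈ Y ⊙ P ⟶ P ⊙ Y -> f ∈ X ⟶ Y ->
  t ∘ (f ⊗ P) = (P ⊗ f) ∘ s -> sharp pp Y t ∘ (Q ⊗ f) = (f ⊗ Q) ∘ sharp pp X s.
Proof.
move=> hs ht hf e; rewrite /sharp.
rewrite -(@compA _ _ _ (Q ⊗ f)); [|composable|composable].
have := slide hf (coev_hom pp); rewrite mtens1r; flatten => e1.
rewrite -!mtensA -tensor_left_comp; last by composable.
rewrite -e1 tensor_left_comp; last by composable.
rewrite compA; [|composable|composable].
rewrite -(@compA _ _ _ (Q ⊗ (f ⊗ _ ⊗ _))); [|composable|composable].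
rewrite -tensor_left_comp; last by composable.
rewrite -tensor_right_comp; last by composable.
rewrite e tensor_right_comp; last by composable.
rewrite tensor_left_comp; last by composable.
rewrite compA; [|composable|composable].
have := slide (ev_hom pp) hf; rewrite mtens1l; flatten => e2.
rewrite -tensor_right_comp; last by composable.
rewrite e2 tensor_right_comp; last by composable.
do 2 (rewrite -compA; [|composable|composable]).
by rewrite -compA; [|composable|composable].
Qed.

Lemma flat_natural X s Y t f :
  s ∈ P ⊙ X ⟶ X ⊙ P -> t ∈ P ⊙ Y ⟶ Y ⊙ P -> f ∈ X ⟶ Y ->
  t ∘ (P ⊗ f) = (f ⊗ P) ∘ s -> flat pp Y t ∘ (f ⊗ Q) = (Q ⊗ f) ∘ flat pp X s.
Proof.
move=> hs ht hf e; rewrite /flat.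
rewrite -(@compA _ _ _ (f ⊗ Q)); [|composable|composable].
have := slide (ucoev_hom pp) hf; rewrite mtens1l; flatten => e1.
rewrite -tensor_right_comp; last by composable.
rewrite e1 tensor_right_comp; last by composable.
rewrite compA; [|composable|composable].
rewrite -(@compA _ _ _ (Q ⊗ P ⊗ f ⊗ Q)); [|composable|composable].
rewrite -tensor_right_comp; last by composable.
rewrite -!(mtensA Q) -tensor_left_comp; last by composable.
rewrite e tensor_left_comp; last by composable.
rewrite tensor_right_comp; last by composable.
rewrite compA; [|composable|composable].
have := slide hf (uev_hom pp); rewrite mtens1r; flatten => e2.
rewrite -!(mtensA Q) -tensor_left_comp; last by composable.
rewrite -e2 tensor_left_comp; last by composable.
do 2 (rewrite -compA; [|composable|composable]).
by rewrite -compA; [|composable|composable].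
Qed.

(** The mate of flat t under P ⊗ - ⊣ Q ⊗ - is t itself, since t ↦ flat t is a
    transposition for the same duality. *)
Lemma mate_flat X t : t ∈ P ⊙ X ⟶ X ⊙ P ->
  (Q ⊗ t) ∘ (ucoev pp ⊗ X) = (flat pp X t ⊗ P) ∘ (X ⊗ ucoev pp).
Proof.
move=> ht; have h : (Q ⊗ t) ∘ (ucoev pp ⊗ X) ∈ X ⟶ (Q ⊙ X) ⊙ P by hom.
rewrite -[LHS](untranspose_transpose_right duality_uev_ucoev h) /flat.
rewrite [X in (_ ∘ X) ⊗ P ∘ _]tensor_right_comp; last by composable.
rewrite compA; [|composable|composable].
by flatten.
Qed.

Section Structure.
Variables (A B : pq_ob pp) (H : ob C) (u : mor C).

Local Notation X := (pq_carrier A).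
Local Notation Y := (pq_carrier B).
Local Notation a := (pq_sigma A).
Local Notation y := (pq_sigma B).

Hypothesis U : universal X H Y u.

Let hu : u ∈ X ⊙ H ⟶ Y := univ_hom U.

Lemma universal_left_P : universal X (P ⊙ H) (P ⊙ Y) ((P ⊗ u) ∘ (a ⊗ H)).
Proof.
have ha := pq_sigma_hom A; have [a' [_ ia]] := pq_obP A.
apply: (universal_tensor_left duality_ev_coev ha ia _ U).
exact: sharp_mate ha.
Qed.

(** If u is a morphism of C(P,Q) for the structure s, and so is a morphism
    X ⊗ W -> Y, then so is the transpose h of the latter: the two sides of the
    conclusion agree after composition with the universal arrow on P ⊗ H. *)
Lemma hom_structure_commutes W w h s :
  w ∈ W ⊙ P ⟶ P ⊙ W -> h ∈ W ⟶ H -> s ∈ H ⊙ P ⟶ P ⊙ H ->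
  y ∘ (u ⊗ P) = (P ⊗ u) ∘ ((a ⊗ H) ∘ (X ⊗ s)) ->
  y ∘ ((u ∘ (X ⊗ h)) ⊗ P) = (P ⊗ (u ∘ (X ⊗ h))) ∘ ((a ⊗ W) ∘ (X ⊗ w)) ->
  s ∘ (h ⊗ P) = (P ⊗ h) ∘ w.
Proof.
move=> hw hh hs es eh; have ha := pq_sigma_hom A; have hy := pq_sigma_hom B.
apply: (univ_eq universal_left_P (W := W ⊙ P)); [hom|hom|].
rewrite !tensor_left_comp; [|composable|composable].
move: eh; rewrite tensor_right_comp; last by composable.
rewrite compA; [|composable|composable].
rewrite es tensor_left_comp; last by composable.
rewrite compA; [|composable|composable].
rewrite compA; [|composable|composable].
rewrite -compA; [|composable|composable].
flatten => ->.
rewrite -(@compA _ (P ⊗ u)); [|composable|composable].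
rewrite (@compA _ _ _ (X ⊗ w)) -?(@compA _ _ (a ⊗ H));
  [|composable|composable|composable|composable].
have := slide ha hh; flatten => <-.
by rewrite compA; [|composable|composable].
Qed.

(** The equation determines s by universality on P ⊗ H.  Each of the four
    composites that must be an identity is cancelled against one of the universal
    arrows on P ⊗ H, H ⊗ P, Q ⊗ H and H ⊗ Q. *)
Lemma hom_structure_exists : exists s,
  pq_axiom pp H s /\ y ∘ (u ⊗ P) = (P ⊗ u) ∘ ((a ⊗ H) ∘ (X ⊗ s)).
Proof.
have [a' [ia ja]] := pq_obP A; have [y' [iy jy]] := pq_obP B.
have [ha ha' a'a aa'] := ia; have [hy hy' y'y yy'] := iy.
have hfa := flat_hom ha'; have hfy := flat_hom hy'.
have hsa := sharp_hom ha; have hsy := sharp_hom hy.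
have [_ _ fsa sfa] := ja; have [_ _ fsy sfy] := jy.
have Up := universal_tensor_right duality_uev_ucoev U.
have Uq := universal_tensor_right duality_ev_coev U.
have Vp := universal_left_P.
have Vq := universal_tensor_left duality_uev_ucoev hfa (inverse_pair_sym ia)
  (mate_flat ha') U.
have [|s hs es] := univ_ex Vp (W := H ⊙ P) (g := y ∘ (u ⊗ P)); first by hom.
have [|t ht et] := univ_ex Up (W := P ⊙ H) (g := y' ∘ ((P ⊗ u) ∘ (a ⊗ H))).
  by hom.
have st : s ∘ t = P ⊙ H.
  apply: (univ_eq Vp (W := P ⊙ H)); [hom|hom|].
  rewrite tensor_left_comp; last by composable.
  rewrite compA; [|composable|composable].
  rewrite es -compA; [|composable|composable].
  rewrite et compA; [|composable|composable].
  by rewrite yy' mtens_idm (compil (univ_hom Vp)) (compir (univ_hom Vp)).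
have ts : t ∘ s = H ⊙ P.
  apply: (univ_eq Up (W := H ⊙ P)); [hom|hom|].
  rewrite tensor_left_comp; last by composable.
  rewrite compA; [|composable|composable].
  rewrite et -compA; [|composable|composable].
  rewrite es compA; [|composable|composable].
  by rewrite y'y mtens_idm (compil (univ_hom Up)) (compir (univ_hom Up)).
have es' : y ∘ (u ⊗ P) = (P ⊗ u) ∘ ((a ⊗ H) ∘ (X ⊗ s)).
  by rewrite -es -compA; [|composable|composable].
exists s; split => //; exists t; split; first by split.
have hfs := sharp_hom hs; have hft := flat_hom ht.
(* Naturality of sharp along u : (X ⊗ H, (a ⊗ H)(X ⊗ s)) -> (Y, y). *)
have natS : (u ⊗ Q) ∘ (X ⊗ sharp pp H s) =
    sharp pp Y y ∘ ((Q ⊗ u) ∘ (flat pp X a' ⊗ H)).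
  have hm : (a ⊗ H) ∘ (X ⊗ s) ∈ X ⊙ H ⊙ P ⟶ P ⊙ (X ⊙ H) by hom.
  have hm' := sharp_hom hm.
  rewrite compA; [|composable|composable].
  rewrite (sharp_natural hm hy hu es') sharp_tens //.
  rewrite -!compA; [|composable|composable|composable|composable].
  rewrite -tensor_right_comp; last by composable.
  by rewrite sfa mtens_idm -otensA (compir (hom_tens (hom_idm X) hfs)).
(* Naturality of flat along u, for the inverse structures. *)
have natF : flat pp Y y' ∘ (u ⊗ Q) =
    (Q ⊗ u) ∘ ((flat pp X a' ⊗ H) ∘ (X ⊗ flat pp H t)).
  have hm : (X ⊗ t) ∘ (a' ⊗ H) ∈ P ⊙ (X ⊙ H) ⟶ X ⊙ H ⊙ P by hom.
  rewrite (flat_natural hm hy' hu) ?flat_tens //.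
  rewrite compA; [|composable|composable].
  rewrite et -!compA; [|composable|composable|composable|composable].
  rewrite -tensor_right_comp; last by composable.
  by rewrite aa' !mtens_idm -otensA (compir (hom_tens (hom_idm P) hu)).
have hUq := univ_hom Uq; have hVq := univ_hom Vq.
split => //.
- apply: (univ_eq Vq (W := Q ⊙ H)); [hom|hom|].
  rewrite tensor_left_comp; last by composable.
  rewrite compA; [|composable|composable].
  rewrite -(@compA _ (Q ⊗ u)); [|composable|composable].
  rewrite -natF -compA; [|composable|composable].
  rewrite natS compA; [|composable|composable].
  by rewrite fsy mtens_idm (compil hVq) (compir hVq).
apply: (univ_eq Uq (W := H ⊙ Q)); [hom|hom|].
rewrite tensor_left_comp; last by composable.
rewrite compA; [|composable|composable].
rewrite natS -compA; [|composable|composable].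
rewrite -(@compA _ (Q ⊗ u)); [|composable|composable].
rewrite -natF compA; [|composable|composable].
by rewrite sfy mtens_idm (compil hUq) (compir hUq).
Qed.

End Structure.
End HomObject.

(** * Lifting the right closed structure *)

Section Lift.
Variables (C : monoidal) (pp : pivotal_pair C) (RC : right_closed C).
Implicit Types (A B W : pq_ob pp).

Local Notation P := (pP pp).
Local Notation "⌊ A ⌋" := (pq_carrier A).
Local Notation "[ X , Y ]" := (fob (ihom RC X) Y).
Local Notation eval X := (adj_counit (ihom_adj RC X)).
Local Notation insert X := (adj_unit (ihom_adj RC X)).

Lemma eval_universal A B :
  universal ⌊A⌋ [⌊A⌋, ⌊B⌋] ⌊B⌋ (eval ⌊A⌋ ⌊B⌋).
Proof. exact: universal_counit. Qed.

(** The structure is selected by choice, which is harmless as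
    [eval_commutes] determines it. *)
Definition pq_hom A B : pq_ob pp :=
  PQOb (proj1 (projT2 (cid (hom_structure_exists (eval_universal A B))))).

Lemma eval_commutes A B :
  pq_sigma B ∘ (eval ⌊A⌋ ⌊B⌋ ⊗ P) =
  (P ⊗ eval ⌊A⌋ ⌊B⌋) ∘ pq_sigma (pq_otens A (pq_hom A B)).
Proof. exact: (proj2 (projT2 (cid (hom_structure_exists (eval_universal A B))))). Qed.

Lemma eval_hom A B :
  eval ⌊A⌋ ⌊B⌋ ∈ ⌊pq_otens A (pq_hom A B)⌋ ⟶ ⌊B⌋.
Proof. exact: univ_hom (eval_universal A B). Qed.

Definition pq_eval A B : pq_mor pp := PQMor (eval_hom A B) (eval_commutes A B).

Lemma transpose_commutes A B W h (g : pq_mor pp) :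
  pq_dom g = pq_otens A W -> pq_cod g = B ->
  h ∈ ⌊W⌋ ⟶ ⌊pq_hom A B⌋ -> eval ⌊A⌋ ⌊B⌋ ∘ (⌊A⌋ ⊗ h) = pq_und g ->
  pq_sigma (pq_hom A B) ∘ (h ⊗ P) = (P ⊗ h) ∘ pq_sigma W.
Proof.
move=> dg cg hh eh.
apply: (hom_structure_commutes (eval_universal A B) (pq_sigma_hom W) hh
  (pq_sigma_hom (pq_hom A B))); first exact: eval_commutes.
by have := pq_und_comm g; rewrite eh dg cg.
Qed.

Section HomFunctor.
Variable A : pq_ob pp.

Lemma ihom_und_hom (f : pq_mor pp) :
  fmor (ihom RC ⌊A⌋) (pq_und f) ∈ ⌊pq_hom A (pq_dom f)⌋ ⟶ ⌊pq_hom A (pq_cod f)⌋.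
Proof.
by have [df cf] := pq_und_hom f; split; rewrite ?dom_fmor ?cod_fmor ?df ?cf.
Qed.

Lemma ihom_und_comm (f : pq_mor pp) :
  pq_sigma (pq_hom A (pq_cod f)) ∘ (fmor (ihom RC ⌊A⌋) (pq_und f) ⊗ P) =
  (P ⊗ fmor (ihom RC ⌊A⌋) (pq_und f)) ∘ pq_sigma (pq_hom A (pq_dom f)).
Proof.
(* [X, f] is the transpose of f after evaluation. *)
apply: (transpose_commutes (g := pq_comp f (pq_eval A (pq_dom f))));
  rewrite ?pq_dom_comp ?pq_cod_comp ?pq_und_comp //; first exact: ihom_und_hom.
have := adj_counit_nat (ihom_adj RC ⌊A⌋) (pq_und f).
by have [-> ->] := pq_und_hom f.
Qed.

Definition pq_hom_mor (f : pq_mor pp) : pq_mor pp :=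
  PQMor (ihom_und_hom f) (ihom_und_comm f).

Lemma pq_hom_mor_idm B : pq_hom_mor (pq_idm B) = pq_idm (pq_hom A B).
Proof. by apply: pq_mor_eq => //=; rewrite fmor_idm. Qed.

Lemma pq_hom_mor_comp (g f : pq_mor pp) : pq_cod f = pq_dom g ->
  pq_hom_mor (pq_comp g f) = pq_comp (pq_hom_mor g) (pq_hom_mor f).
Proof.
move=> e; have e' : pq_cod (pq_hom_mor f) = pq_dom (pq_hom_mor g) by rewrite /= e.
apply: pq_mor_eq; rewrite ?(pq_dom_comp e') ?(pq_cod_comp e') ?(pq_und_comp e') /=
  ?pq_dom_comp ?pq_cod_comp ?pq_und_comp //.
have [_ cf] := pq_und_hom f; have [dg _] := pq_und_hom g.
by rewrite fmor_comp // cf dg e.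
Qed.

Definition pq_hom_functor : functor (pq_monoidal pp) (pq_monoidal pp) :=
  @Functor (pq_monoidal pp) (pq_monoidal pp) (pq_hom A) pq_hom_mor
    (fun _ => erefl) (fun _ => erefl) pq_hom_mor_idm pq_hom_mor_comp.

Lemma insert_hom W : insert ⌊A⌋ ⌊W⌋ ∈ ⌊W⌋ ⟶ ⌊pq_hom A (pq_otens A W)⌋.
Proof. exact: adj_unit_hom. Qed.

Lemma insert_commutes W :
  pq_sigma (pq_hom A (pq_otens A W)) ∘ (insert ⌊A⌋ ⌊W⌋ ⊗ P) =
  (P ⊗ insert ⌊A⌋ ⌊W⌋) ∘ pq_sigma W.
Proof.
(* The unit is the transpose of an identity. *)
apply: (transpose_commutes (g := pq_idm (pq_otens A W))) => //.
  exact: insert_hom.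
exact: triangleL.
Qed.

Definition pq_insert W : pq_mor pp := PQMor (insert_hom W) (insert_commutes W).

(** Left transparent, so that its unit and counit compute to [pq_insert] and
    [pq_eval], whose underlying morphisms are those of the adjunction in C. *)
Definition pq_hom_adjunction :
  adjunction (tensor_left (C := pq_monoidal pp) A) pq_hom_functor.
Proof.
apply: (@Adjunction (pq_monoidal pp) (pq_monoidal pp) _ pq_hom_functor
  pq_insert (pq_eval A)) => //.
- move=> f; apply: pq_mor_eq;
    rewrite ?pq_dom_comp ?pq_cod_comp ?pq_und_comp //=.
  have := adj_unit_nat (ihom_adj RC ⌊A⌋) (pq_und f).
  by have [-> ->] := pq_und_hom f.
- move=> f; apply: pq_mor_eq;
    rewrite ?pq_dom_comp ?pq_cod_comp ?pq_und_comp //=.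
  have := adj_counit_nat (ihom_adj RC ⌊A⌋) (pq_und f).
  by have [-> ->] := pq_und_hom f.
- move=> W; apply: pq_mor_eq;
    rewrite ?pq_dom_comp ?pq_cod_comp ?pq_und_comp //=.
  exact: triangleL.
move=> B; apply: pq_mor_eq; rewrite ?pq_dom_comp ?pq_cod_comp ?pq_und_comp //=.
exact: triangleR.
Defined.

End HomFunctor.

Definition pq_right_closed : right_closed (pq_monoidal pp) :=
  @RightClosed (pq_monoidal pp) pq_hom_functor pq_hom_adjunction.

Lemma closed_comparison_forget A B :
  closed_comparison (forget pp) pq_right_closed RC A B = [⌊A⌋, ⌊B⌋].
Proof.
rewrite /closed_comparison /= (compir (eval_hom A B)); exact: triangleR.
Qed.

End Lift.

Theorem corollary4p3 (C : monoidal) (pp : pivotal_pair C) (RC : right_closed C) :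
  exists RPQ : right_closed (pq_monoidal pp),
    lifts_right_closed (forget_functor pp) RPQ RC /\
    right_closed_functor (forget pp) RPQ RC.
Proof.
exists (pq_right_closed pp RC); split; first by move=> A; split.
move=> A B; rewrite closed_comparison_forget /is_iso dom_idm cod_idm.
by exists (fob (ihom RC (pq_carrier A)) (pq_carrier B)); exact: inverse_pair_id.
Qed.
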